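(* There does not exist a translation hypersurface of type 4 in $\mathbb{I}^4$ with constant Gauss-Kronecker curvature, except the cylindrical hypersurfaces with non-isotropic rulings. Here a translation hypersurface of type 4 is one parameterized by $$r(u,v,w)=\left(f(u)+g(v)+h(w),\ u+v+6w,\ u+v-w,\ u-v+w+\tfrac{5\pi}{6}\right)$$ with $f,g,h$ smooth real functions of one variable and $f'(u)-g'(v)\neq0$.
   Context: The isotropic space $\mathbb{I}^4$ is $\mathbb{R}^4$ with affine coordinates $(x_1,\dots,x_4)$ and the degenerate metric $dx_1^2+dx_2^2+dx_3^2$; lines parallel to the $x_4$-axis are isotropic, all other lines are non-isotropic. All hypersurfaces considered have tangent hyperplanes not parallel to the $x_4$-axis. For a parameterized hypersurface $r$, let $[g_{ij}]$ be the matrix of the first fundamental form induced by the degenerate metric and $h_{ij}=\det(r_u,r_v,r_w,r_{ij})/\sqrt{\det g_{ij}}$, with $r_{ij}$ the second partial derivatives. The (isotropic) Gauss-Kronecker curvature is $K=\det[h_{ij}]/\det[g_{ij}]$. For a type 4 hypersurface (with the sign convention used here) $$K=\frac{8f''g''h''}{49(f'-g')^5}.$$ A hypersurface is cylindrical with non-isotropic rulings if it is generated by mutually parallel non-isotropic lines. *)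

(* Defs.v *)
From mathcomp Require Import all_boot all_order all_algebra.
From mathcomp Require Import all_classical all_reals all_analysis.
Import Order.TTheory GRing.Theory Num.Theory.
Import numFieldNormedType.Exports.

Set Implicit Arguments.
Unset Strict Implicit.
Unset Printing Implicit Defensive.

Local Open Scope classical_set_scope.
Local Open Scope ring_scope.

Definition open_interval (R : realType) (I : set R) : Prop :=
  [/\ open I, is_interval I & I !=set0].

(* [f] is total, but for open [I] the values [derive1n n f x] at [x] in [I] depend
   only on the restriction of [f] to [I]. *)
Definition smooth_on (R : realType) (I : set R) (f : R -> R) : Prop :=
  forall (n : nat) (x : R), I x -> derivable (derive1n n f) x 1.

(* The coordinates x_1, ..., x_4 are indexed by 0, ..., 3, so that x_4 is the
   coordinate of index [ord_max]. *)
Definition iso_dot (R : realType) (x y : 'rV[R]_4) : R :=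
  \sum_(k < 4 | k != ord_max) x 0 k * y 0 k.

(* The zero vector is counted as isotropic, so a non-isotropic vector is a
   genuine direction. *)
Definition isotropic (R : realType) (d : 'rV[R]_4) : Prop :=
  exists c : R, d = c *: delta_mx 0 ord_max.

Section Hypersurface.
Context {R : realType}.
Implicit Types (r : 'rV[R]_3 -> 'rV[R]_4) (p : 'rV[R]_3).

Definition pd1 r (i : 'I_3) p : 'rV[R]_4 := 'D_(delta_mx 0 i) r p.

Definition pd2 r (i j : 'I_3) p : 'rV[R]_4 := pd1 (pd1 r i) j p.

Definition first_form r p : 'M[R]_3 :=
  \matrix_(i, j) iso_dot (pd1 r i p) (pd1 r j p).

Definition second_form r p : 'M[R]_3 :=
  \matrix_(i, j)
    (\det (col_mx (\matrix_(k < 3) pd1 r k p) (pd2 r i j p) : 'M[R]_4)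
     / Num.sqrt (\det (first_form r p))).

Definition gauss_kronecker r p : R :=
  \det (second_form r p) / \det (first_form r p).

End Hypersurface.

Definition line (R : realType) (x d : 'rV[R]_4) : set 'rV[R]_4 :=
  [set x + t *: d | t in [set: R]].

(* A hypersurface parameterized over a bounded domain cannot contain complete
   lines; it is cylindrical when it is an open piece of a union of parallel
   lines ([U = setT] being allowed, and [U] open in the ambient space). *)
Definition cylindrical_nonisotropic (R : realType) (S : set 'rV[R]_4) : Prop :=
  exists (d : 'rV[R]_4) (C U : set 'rV[R]_4),
    [/\ ~ isotropic d, open U & S = (\bigcup_(x in C) line x d) `&` U].

Definition box (R : realType) (I J L : set R) : set 'rV[R]_3 :=
  [set p : 'rV[R]_3 | [/\ I (p 0 0), J (p 0 1) & L (p 0 2%:R)]].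

Definition type4 (R : realType) (f g h : R -> R) (p : 'rV[R]_3) : 'rV[R]_4 :=
  let u := p 0 0 in
  let v := p 0 1 in
  let w := p 0 2%:R in
  \row_(k < 4) nth 0 [:: f u + g v + h w;
                         u + v + 6%:R * w;
                         u + v - w;
                         u - v + w + 5%:R * pi / 6%:R] k.

(* Main.v *)
(** In the parameters the hypersurface is the graph of f(u) + g(v) + h(w) over
    an affine image of the box, and K = 8 f'' g'' h'' / (49 |f' - g'|^5).

    If K is a nonzero constant, then (f' - g')^5 is a product of a function of u
    and a function of v, so all cross-ratios of f' - g' equal 1, which forces f'
    or g' to be constant and hence K = 0.  If K = 0, one of f'', g'', h'' vanishes
    identically, so one of the three functions is affine and the corresponding
    parameter lines are rulings.

    Conversely, a ruling direction d lifts to a constant parameter direction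
    (a, b, c), along which the first coordinate is affine with slope d_1, so
    a f'(u) + b g'(v) + c h'(w) = d_1 on the whole box.  Not all of a, b, c vanish,
    hence one of f', g', h' is constant and K = 0. *)

Require Import Defs.
From mathcomp Require Import all_boot all_order all_algebra.
From mathcomp Require Import all_classical all_reals all_analysis.
From mathcomp Require Import ring lra.
Import Order.TTheory GRing.Theory Num.Theory.
Import numFieldNormedType.Exports.

Local Open Scope classical_set_scope.
Local Open Scope ring_scope.

(** * Indices and determinants of size three *)

Lemma ord3_cases (i : 'I_3) : [\/ i = 0, i = 1 | i = 2%:R].
Proof.
by case: i => [[|[|[|//]]] ?]; [constructor 1|constructor 2|constructor 3];
  apply/val_inj.
Qed.

Lemma det_mx33 (R : comNzRingType) (A : 'M[R]_3) :
  \det A = A 0 0 * (A 1 1 * A 2%:R 2%:R - A 1 2%:R * A 2%:R 1)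
         - A 0 1 * (A 1 0 * A 2%:R 2%:R - A 1 2%:R * A 2%:R 0)
         + A 0 2%:R * (A 1 0 * A 2%:R 1 - A 1 1 * A 2%:R 0).
Proof.
(* Entries are read through natural-number indices, so that ordinals spelled differently after the
   expansions become equal by computation and [ring] applies. *)
have [B AE] : exists B : nat -> nat -> R, forall i j, A i j = B i j.
  by exists (fun i j => A (inord i) (inord j)) => i j; rewrite !inord_val.
rewrite (expand_det_row _ 0) !big_ord_recl big_ord0 /cofactor.
rewrite !(expand_det_row _ 0) !big_ord_recl !big_ord0 /cofactor !det_mx11.
rewrite !mxE !AE /= /bump /=.
ring.
Qed.

(** * Differentiation of the parameterization *)

Section Derivatives.
Context {R : realType}.

Lemma is_derive_coord (n : nat) (f : R -> R) (i : 'I_n) (p v : 'rV[R]_n)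
    (a : R) :
  is_derive (p 0 i) 1 f a ->
  is_derive p v (fun q : 'rV[R]_n => f (q 0 i)) (a * v 0 i).
Proof.
move=> [df fa].
have dc : differentiable (fun q : 'rV[R]_n => q 0 i) p.
  exact: differentiable_coord.
have dfp : differentiable f (p 0 i) by exact/derivable1_diffP.
have dcomp : differentiable (f \o (fun q : 'rV[R]_n => q 0 i)) p.
  exact: differentiable_comp.
split; first exact: diff_derivable.
rewrite (deriveE _ dcomp) diff_comp//= -(deriveE _ dc) deriv1E// derive1E fa.
have idv : derivable (id : _ -> 'rV[R]_n) p v by exact: derivable_id.
have /matrixP/(_ 0 i) := derive_mx idv.
by rewrite derive_id mxE => <-; rewrite mulrC.
Qed.

Lemma is_derive_row (m n : nat) (F : 'rV[R]_m -> 'rV[R]_n) (p v : 'rV[R]_m)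
    (d : 'rV[R]_n) :
  (forall k, is_derive p v (fun q => F q 0 k) (d 0 k)) -> is_derive p v F d.
Proof.
move=> dF.
have derF : derivable F p v.
  by apply/derivable_mxP => i j; rewrite ord1; case: (dF j).
split=> //; rewrite derive_mx//; apply/matrixP => i j; rewrite ord1 mxE.
by case: (dF j).
Qed.

(** The differential of [type4] applied to [v], with [a], [b], [c] standing for the values of f',
    g', h'. Zero slopes leave the linear part of the last three coordinates. *)
Definition type4_velocity (a b c : R) (v : 'rV[R]_3) : 'rV[R]_4 :=
   \row_(k < 4) nth 0 [:: a * v 0 0 + b * v 0 1 + c * v 0 2%:R;
     v 0 0 + v 0 1 + 6%:R * v 0 2%:R;
     v 0 0 + v 0 1 - v 0 2%:R;
     v 0 0 - v 0 1 + v 0 2%:R] k.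

Lemma is_derive_type4 (f g h : R -> R) (p v : 'rV[R]_3) (a b c : R) :
  is_derive (p 0 0) 1 f a -> is_derive (p 0 1) 1 g b ->
  is_derive (p 0 2%:R) 1 h c ->
  is_derive p v (type4 f g h) (type4_velocity a b c v).
Proof.
move=> df dg dh.
have H0 := is_derive_coord _ _ _ _ v _ df.
have H1 := is_derive_coord _ _ _ _ v _ dg.
have H2 := is_derive_coord _ _ _ _ v _ dh.
have E i : is_derive p v (fun q : 'rV[R]_3 => q 0 i) (v 0 i).
  by rewrite -[X in is_derive _ _ _ X]mul1r; apply: (@is_derive_coord _ id).
apply: is_derive_row => k.
rewrite mxE; under eq_fun do rewrite mxE.
case: k => [[|[|[|[|//]]]] ?] /=.
- by apply: is_deriveD.
- by apply: is_deriveD.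
- by apply: is_deriveB.
- rewrite -[X in is_derive _ _ _ X]addr0.
  by apply: is_deriveD.
Qed.

Lemma near_box (I J L : set R) (p : 'rV[R]_3) :
  open I -> open J -> open L -> box I J L p -> \forall q \near p, box I J L q.
Proof.
move=> oI oJ oL [pI pJ pL].
have nearI (A : set R) i : open A -> A (p 0 i) ->
      nbhs p [set q : 'rV[R]_3 | A (q 0 i)].
  by move=> oA Ap; apply: (@coord_continuous _ _ _ 0 i); exact: open_nbhs_nbhs.
by near=> q; split; near: q; exact: nearI.
Unshelve. all: by end_near. Qed.

Lemma smooth_is_derive (A : set R) (k : R -> R) (n : nat) (x : R) :
  smooth_on A k -> A x -> is_derive x 1 (derive1n n k) (derive1n n.+1 k x).
Proof. by move=> sk Ax; rewrite derive1nS derive1E; apply/derivableP/sk. Qed.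

End Derivatives.

(** * Fundamental forms and Gauss-Kronecker curvature *)

Section Curvature.
Context {R : realType}.

Lemma iso_dotE (x y : 'rV[R]_4) :
  iso_dot x y =
  \sum_(k < 3) x 0 (widen_ord (leqnSn 3) k) * y 0 (widen_ord (leqnSn 3) k).
Proof.
rewrite /iso_dot big_mkcond big_ord_recr /= addr0; apply: eq_bigr => k _.
by rewrite -val_eqE /= neq_ltn ltn_ord.
Qed.

(** Laplace expansion along the last row, with cofactor sign (-1)^3. It serves to compute h_ij,
    since the second derivatives of [type4] lie along the first axis. *)
Lemma det_col_mx_delta (A : 'M[R]_(3, 4)) (c : R) :
  \det (col_mx A (c *: delta_mx 0 0) : 'M[R]_4) = - c * \det (col' 0 A).
Proof.
set B := (col_mx A _ : 'M[R]_4).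
have upE (i : 'I_3) j : B (lift ord_max i) j = A i j.
  have -> : lift (ord_max : 'I_4) i = lshift 1 i.
    by apply/val_inj; rewrite /= /bump leqNgt ltn_ord.
  exact: col_mxEu.
have downE j : B ord_max j = c * (j == 0)%:R.
  have -> : ord_max = rshift 3 (0 : 'I_1) by apply/val_inj.
  by rewrite [LHS]col_mxEd !mxE eqxx.
clearbody B.
rewrite (expand_det_row _ ord_max) big_ord_recl.
rewrite big1 => [|j _]; last by rewrite downE /= mulr0 mul0r.
rewrite addr0 downE eqxx /cofactor.
have -> : row' ord_max (col' ord0 B) = col' 0 A.
  by apply/matrixP => i j; rewrite !mxE upE.
rewrite /=; ring.
Qed.

Context (I J L : set R) (f g h : R -> R).
Context (oI : open I) (oJ : open J) (oL : open L).
Context (sf : smooth_on I f) (sg : smooth_on J g) (sh : smooth_on L h).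

Let r := type4 f g h.

Lemma pd1_type4 p i : box I J L p ->
  pd1 r i p = type4_velocity (derive1 f (p 0 0)) (derive1 g (p 0 1))
    (derive1 h (p 0 2%:R)) (delta_mx 0 i).
Proof.
move=> [pI pJ pL]; rewrite /pd1; apply: derive_val.
by apply: is_derive_type4;
  [have := smooth_is_derive _ _ 0 _ sf pI|have := smooth_is_derive _ _ 0 _ sg pJ
  |have := smooth_is_derive _ _ 0 _ sh pL].
Qed.

Lemma pd2_type4 p i j : box I J L p ->
  pd2 r i j p = (nth 0 [:: derive1n 2 f (p 0 0); derive1n 2 g (p 0 1);
     derive1n 2 h (p 0 2%:R)] i *+ (i == j)) *: delta_mx 0 0.
Proof.
move=> bp; have [pI pJ pL] := bp.
pose F : R -> R := nth (cst 0) [:: derive1 f; derive1 g; derive1 h] i.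
pose C : 'rV[R]_4 := type4_velocity 0 0 0 (delta_mx 0 i).
(* A second differentiation needs the formula for [pd1 r i] near [p], not only at [p]: there it is a
   function of one parameter along the first axis, plus a constant. *)
have E : nbhs p
    [set q : 'rV[R]_3 | F (q 0 i) *: delta_mx 0 0 + C = pd1 r i q].
  apply: filterS (near_box _ _ _ _ oI oJ oL bp) => q bq /=.
  rewrite (pd1_type4 _ _ bq); apply/rowP => k; rewrite !mxE.
  have [] := ord3_cases i => iE; rewrite /F iE /=;
    by case: k => [[|[|[|[|//]]]] ?] /=; ring.
have D : is_derive (p 0 i) 1 F (nth 0 [:: derive1n 2 f (p 0 0);
     derive1n 2 g (p 0 1); derive1n 2 h (p 0 2%:R)] i).
  rewrite /F; have [] := ord3_cases i => iE; rewrite iE /=.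
  - exact: smooth_is_derive _ _ 1 _ sf pI.
  - exact: smooth_is_derive _ _ 1 _ sg pJ.
  - exact: smooth_is_derive _ _ 1 _ sh pL.
rewrite /pd2 {1}/pd1 -(near_eq_derive _ E); apply: derive_val.
apply: is_derive_row => k.
under eq_fun do rewrite !mxE mulrC.
apply: is_derive_eq; first apply: is_deriveD.
  apply: is_deriveZ; apply: is_derive_coord; exact: D.
by rewrite !mxE eqxx addr0 [RHS]mulrC [in LHS]mulr_natr.
Qed.

(** The second form is diagonal with entries 2 s_i / |f' - g'|; the absolute value comes from the
    square root in its normalization. *)
Lemma gauss_kronecker_type4 p : box I J L p ->
  derive1 f (p 0 0) - derive1 g (p 0 1) != 0 ->
  gauss_kronecker r p =
    8 * derive1n 2 f (p 0 0) * derive1n 2 g (p 0 1) * derive1n 2 h (p 0 2%:R)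
    / (49 * `|derive1 f (p 0 0) - derive1 g (p 0 1)| ^+ 5).
Proof.
move=> bp fg0.
set a := derive1 f _ in fg0 *; set b := derive1 g _ in fg0 *.
set a2 := derive1n 2 f _; set b2 := derive1n 2 g _; set c2 := derive1n 2 h _.
pose s := [:: a2; b2; c2].
have pd2E i j : pd2 r i j p = (s`_i *+ (i == j)) *: delta_mx 0 0.
  exact: pd2_type4.
have det1 : \det (first_form r p) = (7 * (a - b)) ^+ 2.
  (* [N] is the Jacobian matrix of the first three coordinates, of determinant -7 (a - b), and the
     first form is its Gram matrix. *)
  pose N : 'M[R]_3 := \matrix_(i, j) pd1 r i p 0 (widen_ord (leqnSn 3) j).
  have -> : first_form r p = N *m N^T.
    apply/matrixP => i j; rewrite !mxE iso_dotE.
    by apply: eq_bigr => k _; rewrite !mxE.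
  rewrite det_mulmx det_tr -expr2 -[in RHS]sqrrN.
  rewrite det_mx33 !mxE !(pd1_type4 _ _ bp) !mxE /= -/a -/b.
  ring.
(* The 14 is minus the determinant of the linear part of the last three coordinates. *)
have det2 i j : second_form r p i j = 14 * s`_i / (7 * `|a - b|) * (i == j)%:R.
  rewrite mxE det1 sqrtr_sqr normrM [`|7|]ger0_norm// pd2E.
  rewrite det_col_mx_delta det_mx33.
  rewrite !mxE !(pd1_type4 _ _ bp) !mxE /= -/a -/b.
  ring.
rewrite /gauss_kronecker det1 det_mx33 !det2 /=.
have ab0 : `|a - b| != 0 by rewrite normr_eq0.
have -> : (7 * (a - b)) ^+ 2 = 49 * `|a - b| ^+ 2.
  by rewrite real_normK ?num_real//; ring.
move: `|a - b| ab0 => x x0; clearbody a2 b2 c2.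
by field.
Qed.

End Curvature.

(** * Functions on intervals and separation of variables *)

Section IntervalCalculus.
Context {R : realType}.
Implicit Types (A : set R) (F : R -> R).

Lemma derive1_locally_constant A F c x : open A ->
  (forall y, A y -> F y = c) -> A x -> derive1 F x = 0.
Proof.
move=> oA Fc Ax; rewrite derive1E -(derive_cst c x (1 : R)).
apply: near_eq_derive; apply: filterS (open_nbhs_nbhs (conj oA Ax)) => y Ay.
exact: Fc.
Qed.

Lemma derivable_continuous_segment A F x y : is_interval A ->
  (forall z, A z -> derivable F z 1) -> A x -> A y ->
  {within `[x, y], continuous F}.
Proof.
move=> iA dF Ax Ay; apply: derivable_within_continuous => z zxy.
by apply: dF; apply: (iA x y) => //; rewrite !(itvP zxy).
Qed.

Lemma derive1_constant_affine A F a x y : is_interval A ->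
  (forall z, A z -> is_derive z 1 F a) -> A x -> A y ->
  F y = F x + a * (y - x).
Proof.
move=> iA dF Ax Ay.
wlog xy : x y Ax Ay / x <= y => [H|].
  have [|/ltW] := leP x y; first exact: H.
  by move=> /(H _ _ Ay Ax) ->; ring.
have cF := derivable_continuous_segment _ _ _ _ iA
  (fun z Az => @ex_derive _ _ _ _ _ _ _ (dF z Az)) Ax Ay.
have dF' z : z \in `]x, y[ -> is_derive z 1 F a.
  by move=> zxy; apply: dF; apply: (iA x y) => //; rewrite !ltW ?(itvP zxy).
have [z _ E] := MVT_segment xy dF' cF.
by rewrite -E; ring.
Qed.

(** By the intermediate value theorem, a change of sign would produce a zero. *)
Lemma nonvanishing_same_sign A F x y : is_interval A ->
  (forall z, A z -> derivable F z 1) -> (forall z, A z -> F z != 0) ->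
  A x -> A y -> 0 < F x * F y.
Proof.
move=> iA dF F0 Ax Ay.
wlog xy : x y Ax Ay / x <= y => [H|].
  by have [|/ltW] := leP x y; [exact: H|rewrite mulrC; exact: H].
rewrite lt_neqAle eq_sym mulf_neq0 ?F0//= leNgt; apply/negP => Fneg.
have cF := derivable_continuous_segment _ _ _ _ iA dF Ax Ay.
have [|z zxy Fz] := @IVT _ F x y 0 xy cF.
  by rewrite ge_min le_max; case: (ltrgt0P (F x)) => //; nra.
have Az : A z by apply: (iA x y) => //; rewrite !(itvP zxy).
by have := F0 _ Az; rewrite Fz eqxx.
Qed.

(* A nowhere zero product of a function of [u] and a function of [v] has
   multiplicative cross-ratio 1, and the cross-ratio
   [(p u - q v) (p u' - q v') / ((p u - q v') (p u' - q v))] of differences is 1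
   only if [p u = p u'] or [q v = q v']. *)
Lemma separable_power_difference (I J : set R) (p q a b : R -> R) (k : R)
    (n : nat) :
  is_interval I -> (0 < n)%N ->
  (forall u, I u -> derivable p u 1) ->
  (forall u v, I u -> J v -> p u - q v != 0) -> k != 0 ->
  (forall u v, I u -> J v -> a u * b v = k * `|p u - q v| ^+ n) ->
  forall u u' v v', I u -> I u' -> J v -> J v' -> p u = p u' \/ q v = q v'.
Proof.
move=> iI n0 dp pq0 k0 E u u' v v' Iu Iu' Jv Jv'.
(* The absolute value hides signs; they are recovered from the constant sign of [p x - q w] in
   [x]. *)
have sgn w : J w -> 0 < (p u - q w) * (p u' - q w).
  move=> Jw.
  apply: (nonvanishing_same_sign I (fun x => p x - q w) u u' iI _ _ Iu Iu').
  - by move=> z Iz; apply: derivableB; [exact: dp|exact: derivable_cst].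
  - by move=> z Iz; exact: pq0.
(* The values of [a] and [b] at the two diagonals of the rectangle have the same product, so the
   [n]-th powers agree. *)
have cross : `|(p u - q v) * (p u' - q v')| = `|(p u - q v') * (p u' - q v)|.
  apply/eqP; rewrite -(eqrXn2 n0)// !normrM !exprMn.
  have kk0 : k * k != 0 by rewrite mulf_neq0.
  apply/eqP/(mulfI kk0).
  transitivity (a u * b v * (a u' * b v')); first by rewrite !E//; ring.
  by transitivity (a u * b v' * (a u' * b v)); [ring|rewrite !E//; ring].
have same : (p u - q v) * (p u' - q v') = (p u - q v') * (p u' - q v).
  have pos : 0 < ((p u - q v) * (p u' - q v')) * ((p u - q v') * (p u' - q v)).
    have -> : ((p u - q v) * (p u' - q v')) * ((p u - q v') * (p u' - q v)) =
      ((p u - q v) * (p u' - q v)) * ((p u - q v') * (p u' - q v')) by ring.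
    by rewrite mulr_gt0 ?sgn.
  move/eqP: cross; rewrite eqr_norm2 => /orP[/eqP//|/eqP E'].
  by move: pos; rewrite E' mulNr oppr_gt0 -expr2 ltNge sqr_ge0.
have /eqP : (p u - p u') * (q v - q v') = 0.
  transitivity ((p u - q v) * (p u' - q v') - (p u - q v') * (p u' - q v)).
    ring.
  by rewrite same subrr.
by rewrite mulf_eq0 !subr_eq0 => /orP[] /eqP; [left|right].
Qed.

End IntervalCalculus.

(** * Rulings and their parameter directions *)

Section Cylinders.
Context {R : realType}.
Implicit Types (p q v : 'rV[R]_3) (x d : 'rV[R]_4).

Definition row3 (a b c : R) : 'rV[R]_3 := \row_k nth 0 [:: a; b; c] k.

(* The inverse of the linear part of the last three coordinates of [type4]. *)
Definition type4_direction (d : 'rV[R]_4) : 'rV[R]_3 :=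
  let w := (d 0 1 - d 0 2%:R) / 7 in
  row3 ((d 0 2%:R + d 0 3%:R) / 2) ((d 0 2%:R - d 0 3%:R) / 2 + w) w.

(** A left inverse of [type4] defined on the whole space. It ignores the first coordinate, so it is
    the same for all [f], [g], [h]. *)
Definition type4_parameter (x : 'rV[R]_4) : 'rV[R]_3 :=
  type4_direction (x - (5 * pi / 6) *: delta_mx 0 3%:R).

Lemma row3E a b c : [/\ row3 a b c 0 0 = a, row3 a b c 0 1 = b &
  row3 a b c 0 2%:R = c].
Proof. by rewrite !mxE. Qed.

Lemma row3_eqP p q :
  p 0 0 = q 0 0 -> p 0 1 = q 0 1 -> p 0 2%:R = q 0 2%:R -> p = q.
Proof.
by move=> E0 E1 E2; apply/rowP => k; have [] := ord3_cases k => ->.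
Qed.

Lemma type4_parameterK (f g h : R -> R) p : type4_parameter (type4 f g h p) = p.
Proof. by apply: row3_eqP; rewrite !mxE /=; field. Qed.

Lemma type4_parameter_line x d t :
  type4_parameter (x + t *: d) = type4_parameter x + t *: type4_direction d.
Proof. by apply: row3_eqP; rewrite !mxE /=; field. Qed.

Lemma type4_direction_eq0 d : type4_direction d = 0 ->
  exists c, d = c *: delta_mx 0 0.
Proof.
move=> /rowP E; exists (d 0 0); apply/rowP => k; rewrite !mxE.
have := (E 0, E 1, E 2%:R); rewrite !mxE /= => -[[E0 E1] E2].
have e (i j : 'I_4) : val i = val j -> d 0 i = d 0 j by move=> /val_inj ->.
case: k => [[|[|[|[|//]]]] ?] /=; rewrite ?mulr1 ?mulr0.
- exact: e.
- by rewrite (e _ 1)//; lra.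
- by rewrite (e _ 2%:R)//; lra.
- by rewrite (e _ 3%:R)//; lra.
Qed.

Lemma open_type4_parameter (I J L : set R) : open I -> open J -> open L ->
  open (type4_parameter @^-1` box I J L).
Proof.
move=> oI oJ oL.
have c i : continuous (fun x : 'rV[R]_4 => type4_parameter x 0 i).
  have cD (F G : 'rV[R]_4 -> R) : continuous F -> continuous G ->
      continuous (fun x => F x + G x).
    by move=> cF cG x; exact: continuousD (cF x) (cG x).
  have cB (F G : 'rV[R]_4 -> R) : continuous F -> continuous G ->
      continuous (fun x => F x - G x).
    by move=> cF cG x; exact: continuousB (cF x) (cG x).
  have cM (F : 'rV[R]_4 -> R) a : continuous F -> continuous (fun x => F x * a).
    by move=> cF x; exact: continuousM (cF x) (@cst_continuous _ _ a x).
  have cc (k : 'I_4) : continuous (fun x : 'rV[R]_4 =>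
      (x - (5 * pi / 6) *: delta_mx 0 3%:R) 0 k).
    have -> : (fun x : 'rV[R]_4 => (x - (5 * pi / 6) *: delta_mx 0 3%:R) 0 k) =
        fun x => x 0 k - ((5 * pi / 6) *: delta_mx 0 3%:R : 'rV[R]_4) 0 k.
      by apply/funext => x; rewrite !mxE.
    by apply: cB; [exact: coord_continuous|exact: cst_continuous].
  have -> : (fun x => type4_parameter x 0 i) = fun x =>
    (let y := x - (5 * pi / 6) *: delta_mx 0 3%:R in
    let w := (y 0 1 - y 0 2%:R) / 7 in
    nth 0 [:: (y 0 2%:R + y 0 3%:R) / 2; (y 0 2%:R - y 0 3%:R) / 2 + w; w] i).
    by apply/funext => x; rewrite mxE.
  have [] := ord3_cases i => -> /=.
  - by apply/cM/cD; exact: cc.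
  - by apply: cD; apply/cM/cB; exact: cc.
  - by apply/cM/cB; exact: cc.
have -> : type4_parameter @^-1` box I J L =
   (fun x : 'rV[R]_4 => type4_parameter x 0 0) @^-1` I `&`
   (fun x : 'rV[R]_4 => type4_parameter x 0 1) @^-1` J `&`
   (fun x : 'rV[R]_4 => type4_parameter x 0 2%:R) @^-1` L.
  by apply/seteqP; split=> x /=; [case|case=> -[]].
by apply: openI; [apply: openI|]; apply: open_comp => // x _; exact: c.
Qed.

(** Lines of direction [v] in the box map into lines of one direction. The condition on [v] makes
    the second coordinate of that direction nonzero, so it is not isotropic. *)
Lemma cylindrical_of_affine (I J L : set R) (f g h : R -> R) v (m : R) :
  open I -> open J -> open L -> v 0 0 + v 0 1 + 6 * v 0 2%:R != 0 ->
  (forall p t, box I J L p -> box I J L (p + t *: v) ->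
    type4 f g h (p + t *: v) 0 0 = type4 f g h p 0 0 + t * m) ->
  cylindrical_nonisotropic (type4 f g h @` box I J L).
Proof.
move=> oI oJ oL v0 aff.
pose d : 'rV[R]_4 := type4_velocity 0 0 0 v + m *: delta_mx 0 0.
have dv : type4_direction d = v.
  by apply: row3_eqP; rewrite !mxE /=; field.
have lineE p t : box I J L p -> box I J L (p + t *: v) ->
    type4 f g h (p + t *: v) = type4 f g h p + t *: d.
  move=> bp bpt; have E := aff _ _ bp bpt.
  apply/rowP => -[[|[|[|[|//]]]] lt_k4].
  - have -> : Ordinal lt_k4 = 0 by apply/val_inj.
    by rewrite E !mxE /=; ring.
  - by rewrite !mxE /=; ring.
  - by rewrite !mxE /=; ring.
  - by rewrite !mxE /=; ring.
(* The base points are the surface itself; the open set keeps exactly the points of the rulings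
   whose parameters lie in the box. *)
exists d, (type4 f g h @` box I J L), (type4_parameter @^-1` box I J L); split.
- move=> [c /rowP/(_ 1)]; rewrite !mxE /= mulr0 addr0 mulr0 => /eqP.
  exact/negP.
- exact: open_type4_parameter.
- apply/seteqP; split=> y.
  + move=> [p bp <-]; split; last by rewrite /= type4_parameterK.
    exists (type4 f g h p); first by exists p.
    by exists 0 => //; rewrite scale0r addr0.
  + move=> [[_ [p bp <-] [t _ <-]]] /=.
    rewrite type4_parameter_line type4_parameterK dv => bpt.
    by exists (p + t *: v) => //; rewrite lineE.
Qed.

(** Openness of [U] keeps a short piece of each ruling in the surface. [type4_parameter] lifts it to
    a straight segment, along which the difference quotients equal [d]. *)
Lemma cylindrical_velocity (I J L : set R) (f g h : R -> R) :
  cylindrical_nonisotropic (type4 f g h @` box I J L) ->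
  exists d, ~ isotropic d /\ forall p, box I J L p ->
    is_derive p (type4_direction d) (type4 f g h) d.
Proof.
move=> [d [C [U [nd oU SE]]]]; exists d; split=> // p bp.
have near_line : \forall t \near (0 : R),
    type4 f g h (t *: type4_direction d + p) = t *: d + type4 f g h p.
  have Up : U (type4 f g h p).
    suff [] : ((\bigcup_(x in C) line x d) `&` U) (type4 f g h p) by [].
    by rewrite -SE; exists p.
  have [x Cx [s _ xE]] : (\bigcup_(x in C) line x d) (type4 f g h p).
    suff [] : ((\bigcup_(x in C) line x d) `&` U) (type4 f g h p) by [].
    by rewrite -SE; exists p.
  have cl : (t *: d + type4 f g h p) @[t --> (0:R)] --> type4 f g h p.
    rewrite -[X in _ --> X]add0r -[X in X + _](scale0r d).
    apply: cvgD; last exact: cvg_cst.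
    exact: scalel_continuous.
  have near_U : \forall t \near (0 : R), U (t *: d + type4 f g h p).
    exact: cl _ (open_nbhs_nbhs (conj oU Up)).
  apply: filterS near_U => t Ut.
  have : ((\bigcup_(x in C) line x d) `&` U) (t *: d + type4 f g h p).
    split=> //; exists x => //; exists (s + t) => //.
    by rewrite -xE scalerDl addrA addrC.
  rewrite -SE => -[q bq qE].
  suff -> : t *: type4_direction d + p = q by [].
  by rewrite -(type4_parameterK f g h q) qE
    [t *: d + _]addrC type4_parameter_line type4_parameterK addrC.
have quotientE : \forall t \near (0 : R)^', t^-1 *:
    ((type4 f g h \o shift p) (t *: type4_direction d) - type4 f g h p) = d.
  rewrite near_withinE; apply: filterS near_line => t /= -> t0.
  by rewrite addrK scalerA mulVf// scale1r.
by split; [apply: (is_cvg_near_cst d)|apply/lim_near_cst].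
Qed.

End Cylinders.

Theorem theorem6p1 (R : realType) (I J L : set R) (f g h : R -> R)
    (oI : open_interval I) (oJ : open_interval J) (oL : open_interval L)
    (sf : smooth_on I f) (sg : smooth_on J g) (sh : smooth_on L h)
    (fg : forall u v : R, I u -> J v -> derive1 f u - derive1 g v != 0) :
  (exists K : R, forall p : 'rV[R]_3, box I J L p ->
     gauss_kronecker (type4 f g h) p = K)
  <-> cylindrical_nonisotropic (type4 f g h @` box I J L).
Proof.
have [oI' iI [u0 Iu0]] := oI; have [oJ' iJ [v0 Jv0]] := oJ.
have [oL' iL [w0 Lw0]] := oL.
have boxE u v w : I u -> J v -> L w -> box I J L (row3 u v w).
  by move=> Iu Jv Lw; have [E0 E1 E2] := row3E u v w; split; rewrite ?E0 ?E1 ?E2.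
have GK p : box I J L p -> gauss_kronecker (type4 f g h) p =
    8 * derive1n 2 f (p 0 0) * derive1n 2 g (p 0 1) * derive1n 2 h (p 0 2%:R)
    / (49 * `|derive1 f (p 0 0) - derive1 g (p 0 1)| ^+ 5).
  move=> bp; apply: (@gauss_kronecker_type4 _ I J L) => //.
  by have [pI pJ _] := bp; exact: fg.
split=> [[K KE]|/cylindrical_velocity[d [nd dE]]].
(* Constant curvature implies cylindrical: first the denominator is cleared. *)
- have prodE u v w : I u -> J v -> L w ->
      derive1n 2 f u * derive1n 2 g v * derive1n 2 h w =
      49 * K / 8 * `|derive1 f u - derive1 g v| ^+ 5.
    move=> Iu Jv Lw; have := KE _ (boxE _ _ _ Iu Jv Lw).
    rewrite (GK _ (boxE _ _ _ Iu Jv Lw)).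
    have [-> -> ->] := row3E u v w => <-.
    have := fg _ _ Iu Jv; rewrite -normr_eq0.
    move: `|_| (derive1n 2 f u) (derive1n 2 g v) (derive1n 2 h w) => x a b c x0.
    by field.
  have K0 : K = 0.
    apply/eqP/negPn/negP => Kn0.
    have prod_neq0 u v : I u -> J v ->
        derive1n 2 f u * derive1n 2 g v * derive1n 2 h w0 != 0.
      move=> Iu Jv; rewrite prodE// mulf_neq0 ?expf_neq0 ?normr_eq0 ?fg//.
      by rewrite mulf_neq0 ?invr_eq0// mulf_neq0.
    have := prod_neq0 _ _ Iu0 Jv0.
    rewrite !mulf_eq0 !negb_or => /andP[/andP[f2 g2] h2].
    have k0 : 49 * K / 8 / derive1n 2 h w0 != 0.
      by rewrite !mulf_neq0 ?invr_eq0.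
    (* Freezing [w] at [w0] and dividing by h''(w0) separates the variables [u] and [v]. *)
    have sep u v : I u -> J v -> derive1n 2 f u * derive1n 2 g v =
        49 * K / 8 / derive1n 2 h w0 * `|derive1 f u - derive1 g v| ^+ 5.
      by move=> Iu Jv; rewrite mulrAC -(prodE _ _ _ Iu Jv Lw0) mulfK.
    have cst := separable_power_difference I J (derive1 f) (derive1 g)
      (derive1n 2 f) (derive1n 2 g) _ 5 iI isT
      (fun u Iu => sf 1 u Iu) fg k0 sep.
    (* If f' is constant, f''(u0) = 0. Otherwise some [u] has f'(u) different from f'(u0), and the
       dichotomy makes g' constant, so g''(v0) = 0. *)
    have [f_cst|/existsNP[u /not_implyP[Iu fu]]] :=
      pselect (forall u, I u -> derive1 f u = derive1 f u0).
      move/eqP: f2; apply; exact: derive1_locally_constant oI' f_cst Iu0.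
    move/eqP: g2; apply; apply: (@derive1_locally_constant _ J _ (derive1 g v0))
      => //.
    by move=> v Jv; have [/fu|] := cst _ _ _ _ Iu Iu0 Jv Jv0.
  (* A product of functions of independent variables vanishes identically only if one factor
     does. *)
  have flat : [\/ forall u, I u -> derive1n 2 f u = 0,
      forall v, J v -> derive1n 2 g v = 0 | forall w, L w -> derive1n 2 h w = 0].
    have [|/existsNP[u /not_implyP[Iu /eqP fu]]] :=
      pselect (forall u, I u -> derive1n 2 f u = 0); first by constructor 1.
    have [|/existsNP[v /not_implyP[Jv /eqP gv]]] :=
      pselect (forall v, J v -> derive1n 2 g v = 0); first by constructor 2.
    constructor 3 => w Lw; have := prodE _ _ _ Iu Jv Lw.
    rewrite K0 mulr0 !mul0r => E.
    by apply: (mulfI (mulf_neq0 fu gv)); rewrite mulr0.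
  have aff (A : set R) (k : R -> R) (x0 x y : R) : open_interval A -> smooth_on A k ->
      (forall x, A x -> derive1n 2 k x = 0) -> A x0 -> A x -> A y ->
      k y = k x + derive1 k x0 * (y - x).
    move=> [_ iA _] sk k2 Ax0 Ax Ay.
    apply: (@derive1_constant_affine _ A) => // z Az.
    have dk t : A t -> is_derive t 1 (derive1 k) 0.
      by move=> At; rewrite -(k2 _ At); exact: smooth_is_derive _ _ 1 _ sk At.
    have -> : derive1 k x0 = derive1 k z.
      have := derive1_constant_affine _ _ _ _ _ iA dk Az Ax0.
      by rewrite mul0r addr0.
    exact: smooth_is_derive _ _ 0 _ sk Az.
  (* The rulings are the parameter lines of the affine function, whose slope is that of the first
     coordinate. *)
  have [f2|g2|h2] := flat.
  + apply: (@cylindrical_of_affine _ I J L f g h (delta_mx 0 0)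
      (derive1 f u0)) => //.
      by rewrite !mxE /= mulr0 !addr0 oner_neq0.
    move=> p t [pI pJ pL] [pI' pJ' pL']; rewrite !mxE /= in pI' pJ' pL' *.
    by rewrite (aff _ _ _ _ _ oI sf f2 Iu0 pI pI') !mulr0 !addr0; ring.
  + apply: (@cylindrical_of_affine _ I J L f g h (delta_mx 0 1)
      (derive1 g v0)) => //.
      by rewrite !mxE /= mulr0 add0r addr0 oner_neq0.
    move=> p t [pI pJ pL] [pI' pJ' pL']; rewrite !mxE /= in pI' pJ' pL' *.
    by rewrite (aff _ _ _ _ _ oJ sg g2 Jv0 pJ pJ') !mulr0 !addr0; ring.
  + apply: (@cylindrical_of_affine _ I J L f g h (delta_mx 0 2%:R)
      (derive1 h w0)) => //.
      by rewrite !mxE /= mulr1 !add0r.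
    move=> p t [pI pJ pL] [pI' pJ' pL']; rewrite !mxE /= in pI' pJ' pL' *.
    by rewrite (aff _ _ _ _ _ oL sh h2 Lw0 pL pL') !mulr0 !addr0; ring.
- pose v := type4_direction d.
  (* Conversely, the velocity along [v] computed from [type4] must equal [d]; this is its first
     coordinate. *)
  have slopeE u w z : I u -> J w -> L z ->
     derive1 f u * v 0 0 + derive1 g w * v 0 1 + derive1 h z * v 0 2%:R = d 0 0.
    move=> Iu Jw Lz; have [E0 E1 E2] := row3E u w z.
    have D := is_derive_type4 f g h (row3 u w z) v
      (derive1 f u) (derive1 g w) (derive1 h z).
    rewrite E0 E1 E2 in D.
    have {}D := D (smooth_is_derive _ _ 0 _ sf Iu) (smooth_is_derive _ _ 0 _ sg Jw)
      (smooth_is_derive _ _ 0 _ sh Lz).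
    have D' := dE _ (boxE _ _ _ Iu Jw Lz).
    have <- : type4_velocity (derive1 f u) (derive1 g w) (derive1 h z) v = d.
      by rewrite -(@derive_val _ _ _ _ _ _ _ D) (@derive_val _ _ _ _ _ _ _ D').
    by rewrite [RHS]mxE.
  exists 0 => p bp; have [pI pJ pL] := bp.
  suff : [\/ derive1n 2 f (p 0 0) = 0, derive1n 2 g (p 0 1) = 0
      | derive1n 2 h (p 0 2%:R) = 0].
    rewrite (GK _ bp); move: (derive1n 2 f _) (derive1n 2 g _) (derive1n 2 h _).
    by move: (_ ^-1) => e a b c; case=> ->; ring.
  (* Varying one parameter alone shows that a nonzero component of [v] makes the corresponding
     derivative constant. *)
  have [v0'|v0'] := eqVneq (v 0 0) 0; last first.
    constructor 1; apply: (@derive1_locally_constant _ I _ (derive1 f u0)) => // u Iu.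
    apply: (mulIf v0').
    by have := slopeE _ _ _ Iu Jv0 Lw0; rewrite -(slopeE _ _ _ Iu0 Jv0 Lw0); lra.
  have [v1'|v1'] := eqVneq (v 0 1) 0; last first.
    constructor 2; apply: (@derive1_locally_constant _ J _ (derive1 g v0)) => // u Ju.
    apply: (mulIf v1').
    by have := slopeE _ _ _ Iu0 Ju Lw0; rewrite -(slopeE _ _ _ Iu0 Jv0 Lw0); lra.
  have [v2'|v2'] := eqVneq (v 0 2%:R) 0; last first.
    constructor 3; apply: (@derive1_locally_constant _ L _ (derive1 h w0)) => // u Lu.
    apply: (mulIf v2').
    by have := slopeE _ _ _ Iu0 Jv0 Lu; rewrite -(slopeE _ _ _ Iu0 Jv0 Lw0); lra.
  (* With [v] zero, [d] lies on the first axis and its slope vanishes, so [d] is zero, which counts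
     as isotropic. *)
  have v_eq0 : v = 0 by apply: row3_eqP; rewrite [RHS]mxE.
  have [c dc] := type4_direction_eq0 _ v_eq0.
  have c0 : c = 0.
    have := slopeE _ _ _ Iu0 Jv0 Lw0.
    by rewrite v_eq0 dc !mxE /= !mulr0 !addr0 mulr1.
  by case: nd; exists 0; rewrite dc c0 !scale0r.
Qed.
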